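(* Let $\varphi=(1+\sqrt5)/2$ and let $T\approx1.83929$ be the real root of $T^3=T^2+T+1$. For every $\omega\in(1-\varphi/2,\ \varphi-1)$ and every $$0<\varepsilon<\varepsilon^\ast:=\min\Bigl(\tfrac{T-\varphi}{3},\ \tfrac{\varphi/2-\omega}{2},\ \tfrac{4\sqrt5-8-\varphi/2}{2}\Bigr)$$ (all three bounds being positive), the instance with planar disk pan of radius $R=\varphi+1$, width $w=\omega$ and radii $$\bigl\{\varphi,\ 1,\ \tfrac\varphi2+2\varepsilon,\ \tfrac\varphi2+\varepsilon\bigr\}$$ has $\rho=\varphi+3\varepsilon<T$, its lex-max set consists of all four rings, and the descending greedy under worst fit places only three rings. In particular placement obliviousness fails at $\rho=\varphi+3\varepsilon$.
   Context: Model. Fix a width $w>0$ and a pan, here a closed disk of radius $R$ in the plane. An inventory is a finite list of radii $r_1>r_2>\dots>r_n>0$; ring $i$ has outer radius $r_i$ and hole radius $\max(0,r_i-w)$. A placement of a set $S$ of rings is a forest: each ring of $S$ has as parent either the pan or another ring of $S$ with $r_{\mathrm{child}}\le r_{\mathrm{parent}}-w$, and the children of each common parent must be packable in the parent's region (the pan, or a disk of radius $r-w$ for the hole of a ring of radius $r$), i.e. closed disks having the children's outer radii can be positioned inside that region with pairwise disjoint interiors. Feasibility depends only on the parent assignment (siblings may be rearranged freely). $S$ is feasible if it has a placement. The lex-max set is obtained by scanning the rings in decreasing radius and including ring $i$ whenever the already included rings together with $i$ form a feasible set. A descending greedy processes the rings in decreasing radius; when ring $i$ is processed, a container (the pan or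 the hole of an already placed ring) admits it if the container's current children together with ring $i$ are packable in it; the ring receives some admitting container as its permanent parent, and is skipped only if no container admits it. Worst fit chooses the admitting container of largest capacity (radius). Placement obliviousness holds on an instance if every descending greedy execution, with any choice of admitting containers, places exactly the lex-max set. $\rho=\max_i\bigl(\sum_{j>i}r_j\bigr)/r_i$. *)

(* Defs.v *)
From mathcomp Require Import all_boot all_order all_algebra.
From mathcomp Require Import all_classical all_reals all_analysis.
Set Implicit Arguments.
Unset Strict Implicit.
Unset Printing Implicit Defensive.
Import Order.TTheory GRing.Theory Num.Theory.
Import numFieldNormedType.Exports.
Local Open Scope classical_set_scope.
Local Open Scope ring_scope.

Section Plane.
Variable R : realType.

(* The canonical norm of [R * R] is the sup norm, so the Euclidean distance is
   written out; both induce the product topology, used for interiors. *)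
Definition euclid_dist (p q : R * R) : R :=
  Num.sqrt ((p.1 - q.1) ^+ 2 + (p.2 - q.2) ^+ 2).

Definition closed_disk (c : R * R) (rho : R) : set (R * R) :=
  [set p | euclid_dist c p <= rho].

Definition packable (region : set (R * R)) (I : finType) (r : I -> R)
    (C : {set I}) : Prop :=
  exists c : I -> R * R,
    (forall i, i \in C -> closed_disk (c i) (r i) `<=` region) /\
    (forall i j, i \in C -> j \in C -> i != j ->
       interior (closed_disk (c i) (r i)) `&`
       interior (closed_disk (c j) (r j)) = set0).

End Plane.

(* [None] is the pan, [Some j] is the hole of ring [j]. *)
Definition container (n : nat) : Type := option 'I_n.

(* [a i = None] when ring [i] is not placed, and [a i = Some c] when it is
   placed with parent [c]. *)
Definition assignment (n : nat) : Type := {ffun 'I_n -> option (option 'I_n)}.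

Definition empty_assignment (n : nat) : assignment n := [ffun _ => None].

Definition placed (n : nat) (a : assignment n) : {set 'I_n} :=
  [set i | a i != None].

Definition children (n : nat) (a : assignment n) (c : container n) :
    {set 'I_n} :=
  [set i | a i == Some c].

Definition put (n : nat) (a : assignment n) (i : 'I_n) (c : container n) :
    assignment n :=
  [ffun j => if j == i then Some c else a j].

Section Rings.
Variables (R : realType) (n : nat).
(* pan radius, ring width, and outer radii in decreasing order *)
Variables (P w : R) (r : n.-tuple R).

Definition is_instance : Prop :=
  [/\ 0 < P, 0 < w, all (fun x => 0 < x) r & sorted (fun x y => y < x) r].

Definition capacity (c : container n) : R :=
  if c is Some j then Num.max 0 (tnth r j - w) else P.

Definition region (c : container n) : set (R * R) :=
  closed_disk (0, 0) (capacity c).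

(* For positive [w] and [r], the inequality makes a parent strictly larger than
   its child, so that the parent relation is automatically a forest. *)
Definition is_placement (a : assignment n) : Prop :=
  (forall i j : 'I_n, a i = Some (Some j) ->
     j \in placed a /\ tnth r i <= tnth r j - w) /\
  (forall c : container n, packable (region c) (tnth r) (children a c)).

Definition feasible (S : {set 'I_n}) : Prop :=
  exists a : assignment n, placed a = S /\ is_placement a.

(* [enum 'I_n] lists the indices increasingly, i.e. the radii decreasingly. *)
Definition lex_max : {set 'I_n} :=
  foldl (fun S i => if `[< feasible (i |: S)%SET >] then (i |: S)%SET else S)
    finset.set0 (enum 'I_n).

Definition admits (a : assignment n) (i : 'I_n) (c : container n) : Prop :=
  (if c is Some j then j \in placed a else true) /\
  packable (region c) (tnth r) (i |: children a c)%SET.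

(* A policy [pol a i c] says which admitting containers [c] may receive ring
   [i] in state [a]. *)
Definition policy : Type := assignment n -> 'I_n -> container n -> Prop.

Definition any_fit : policy := admits.

Definition worst_fit : policy := fun a i c =>
  admits a i c /\ forall c', admits a i c' -> capacity c' <= capacity c.

Definition greedy_step (pol : policy) (a : assignment n) (i : 'I_n)
    (a' : assignment n) : Prop :=
  (exists c, pol a i c /\ a' = put a i c) \/
  ((forall c, ~ admits a i c) /\ a' = a).

Fixpoint greedy_from (pol : policy) (s : seq 'I_n) (a b : assignment n) :
    Prop :=
  if s is i :: s' then
    exists a', greedy_step pol a i a' /\ greedy_from pol s' a' b
  else b = a.

(* [b] is the final state of a descending greedy execution. *)
Definition greedy_result (pol : policy) (b : assignment n) : Prop :=
  greedy_from pol (enum 'I_n) (empty_assignment n) b.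

Definition placement_oblivious : Prop :=
  forall b, greedy_result any_fit b -> placed b = lex_max.

Definition tail_ratio : R :=
  \big[Num.max/0]_(i < n) ((\sum_(j < n | (i < j)%N) tnth r j) / tnth r i).

End Rings.

Definition golden (R : realType) : R := (1 + Num.sqrt 5) / 2.

(* Main.v *)
Require Import Defs.
From mathcomp Require Import all_boot all_order all_algebra.
From mathcomp Require Import all_classical all_reals all_analysis.
From mathcomp Require Import ring lra.
Import Order.TTheory GRing.Theory Num.Theory.
Import numFieldNormedType.Exports.
Local Open Scope classical_set_scope.
Local Open Scope ring_scope.

(** The pan has radius [phi + 1], so the rings of radii [phi] and [1] placed in
    it side by side are forced onto a diameter, and the largest disk that fits
    next to them has radius
    [phi * 1 * (phi + 1) / (phi ^ 2 + phi + 1) = phi / 2] ([packable_le3],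
    [pan_blocked]). The two remaining rings are just larger than that. Worst
    fit creates this configuration, because the pan has a larger capacity than
    any hole. The third ring then goes into the hole of the first; the fourth
    fits neither next to it there, nor in the pan, nor in a hole of radius at
    most [1 - omega < phi / 2], and is skipped ([worst_fit_run]).

    Putting the unit ring into the hole of the first ring instead, which has
    radius [phi - omega > 1], leaves the pan to the disks of radii [phi],
    [phi / 2 + 2 eps] and [phi / 2 + eps]. These fit, since next to a disk of
    radius [phi] the pan holds two disks of radius [4 sqrt 5 - 8 > phi / 2]
    ([packable_triple]). Hence all four rings form a feasible set, and the
    lex-max set, whose scan meets only prefixes of the list, is everything
    ([lex_max_full]). Worst fit being one of the greedy executions, placement
    obliviousness fails.

    The geometric input is the translation of packability into inequalities
    between distances of centres ([packable_diskP]). *)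

(** * Disks in the Euclidean plane *)

Section EuclideanDisks.
Set Implicit Arguments.
Unset Strict Implicit.
Variable R : realType.
Implicit Types (p q c o : R * R) (r d : R).

Lemma euclid_dist_ge0 p q : 0 <= euclid_dist p q.
Proof. exact: sqrtr_ge0. Qed.

Lemma euclid_dist_sqr p q :
  euclid_dist p q ^+ 2 = (p.1 - q.1) ^+ 2 + (p.2 - q.2) ^+ 2.
Proof. by rewrite sqr_sqrtr// addr_ge0 ?sqr_ge0. Qed.

Lemma euclid_dist_le p q d : 0 <= d ->
  (euclid_dist p q <= d) = ((p.1 - q.1) ^+ 2 + (p.2 - q.2) ^+ 2 <= d ^+ 2).
Proof.
by move=> d0; rewrite -euclid_dist_sqr ler_sqr// nnegrE// euclid_dist_ge0.
Qed.

Lemma le_euclid_dist p q d : 0 <= d ->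
  (d <= euclid_dist p q) = (d ^+ 2 <= (p.1 - q.1) ^+ 2 + (p.2 - q.2) ^+ 2).
Proof.
by move=> d0; rewrite -euclid_dist_sqr ler_sqr// nnegrE// euclid_dist_ge0.
Qed.

Lemma euclid_distC p q : euclid_dist p q = euclid_dist q p.
Proof. by rewrite /euclid_dist -sqrrN opprB -[X in _ + X]sqrrN opprB. Qed.

Lemma euclid_dist_triangle q p o :
  euclid_dist p o <= euclid_dist p q + euclid_dist q o.
Proof.
have a0 := euclid_dist_ge0 p q; have b0 := euclid_dist_ge0 q o.
rewrite euclid_dist_le ?addr_ge0// [leRHS]sqrrD !euclid_dist_sqr.
(* This is the Cauchy-Schwarz inequality for [p - q] and [q - o]. *)
have: (p.1 - q.1) * (q.1 - o.1) + (p.2 - q.2) * (q.2 - o.2) <=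
    euclid_dist p q * euclid_dist q o.
  apply: le_trans (ler_norm _) _.
  rewrite -ler_sqr ?nnegrE ?mulr_ge0// exprMn !euclid_dist_sqr real_normK ?num_real//.
  rewrite -subr_ge0.
  have -> : ((p.1 - q.1) ^+ 2 + (p.2 - q.2) ^+ 2) *
     ((q.1 - o.1) ^+ 2 + (q.2 - o.2) ^+ 2) -
     ((p.1 - q.1) * (q.1 - o.1) + (p.2 - q.2) * (q.2 - o.2)) ^+ 2 =
     ((p.1 - q.1) * (q.2 - o.2) - (p.2 - q.2) * (q.1 - o.1)) ^+ 2 by ring.
  exact: sqr_ge0.
by lra.
Qed.

Lemma euclid_dist_along c (v : R * R) (t : R) :
  euclid_dist c (c + (t * v.1, t * v.2)) = `|t| * euclid_dist (0, 0) v.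
Proof.
rewrite /euclid_dist -sqrtr_sqr -sqrtrM ?sqr_ge0//.
by congr Num.sqrt; rewrite /=; ring.
Qed.

(** Prolonging the segment from [o] to [c] by length [d]: distances add along
    a ray. When [c = o] every direction serves. *)
Lemma euclid_dist_prolong o c d : 0 <= d ->
  exists q, euclid_dist c q = d /\ euclid_dist o q = euclid_dist o c + d.
Proof.
move=> d0; have m0 := euclid_dist_ge0 o c.
have [m_eq0|m_neq0] := eqVneq (euclid_dist o c) 0.
  exists (c + (d * 1, d * 0)).
  have cq : euclid_dist c (c + (d * 1, d * 0)) = d.
    rewrite (euclid_dist_along c (1, 0)) ger0_norm// /euclid_dist /=.
    by rewrite !sub0r sqrrN expr1n oppr0 expr0n addr0 sqrtr1 mulr1.
  split=> //; rewrite m_eq0 add0r -[RHS]cq.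
  have : (o.1 - c.1) ^+ 2 + (o.2 - c.2) ^+ 2 = 0.
    by rewrite -euclid_dist_sqr m_eq0 expr0n.
  move/eqP; rewrite paddr_eq0 ?sqr_ge0// !sqrf_eq0 !subr_eq0.
  by rewrite /euclid_dist => /andP[/eqP-> /eqP->].
have mgt0 : 0 < euclid_dist o c by rewrite lt_def m_neq0.
pose v := c - o.
have v_m : euclid_dist (0, 0) v = euclid_dist o c.
  by rewrite /euclid_dist; congr Num.sqrt; rewrite /v /=; ring.
exists (c + (d / euclid_dist o c * v.1, d / euclid_dist o c * v.2)); split.
  by rewrite euclid_dist_along v_m ger0_norm ?divr_ge0// divfK.
have -> : c + (d / euclid_dist o c * v.1, d / euclid_dist o c * v.2) =
    o + ((1 + d / euclid_dist o c) * v.1, (1 + d / euclid_dist o c) * v.2).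
  by rewrite /v; case: (c) (o) => [a1 a2] [b1 b2]; congr pair => /=; ring.
rewrite euclid_dist_along v_m ger0_norm ?addr_ge0 ?divr_ge0//.
by rewrite mulrDl mul1r divfK.
Qed.

Lemma closed_disk_subset o c r P : 0 <= r ->
  closed_disk c r `<=` closed_disk o P <-> euclid_dist o c + r <= P.
Proof.
move=> r0; split=> [sub|le p cp].
  have [q [cq oq]] := euclid_dist_prolong o c r0.
  by rewrite -oq; apply: sub; rewrite /closed_disk/= cq.
rewrite /closed_disk/=; apply: le_trans (euclid_dist_triangle c _ _) _.
by apply: le_trans le; rewrite lerD2l.
Qed.

Lemma norm_le_euclid_dist p q :
  `|p.1 - q.1| <= euclid_dist p q /\ `|p.2 - q.2| <= euclid_dist p q.
Proof. by split; rewrite -sqrtr_sqr ler_wsqrtr// ?lerDl ?lerDr sqr_ge0. Qed.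

Lemma euclid_dist_le_norm p q :
  euclid_dist p q <= `|p.1 - q.1| + `|p.2 - q.2|.
Proof.
rewrite euclid_dist_le ?addr_ge0// [leRHS]sqrrD !real_normK ?num_real//.
by rewrite addrAC lerDl mulrn_wge0// mulr_ge0.
Qed.

(** The ambient topology of the plane is that of the sup norm, which is
    squeezed between multiples of the Euclidean one. A point at distance
    exactly [r] from [c] is not interior because moving it slightly away from
    [c] leaves the disk. *)
Lemma interior_closed_disk c r :
  interior (closed_disk c r) = [set p | euclid_dist c p < r].
Proof.
apply/seteqP; split=> p /=.
  move=> /nbhs_ballP[e /= e0 sub].
  have e2 : 0 <= e / 2 by rewrite divr_ge0// ltW.
  have [q [pq cq]] := euclid_dist_prolong c p e2.
  have: closed_disk c r q.
    apply: sub; have [h1 h2] := norm_le_euclid_dist p q.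
    by split; rewrite /ball/=; [apply: le_lt_trans h1 _|apply: le_lt_trans h2 _];
       rewrite pq ltr_pdivrMr// ltr_pMr// ltr1n.
  by rewrite /closed_disk/= cq; apply: lt_le_trans; rewrite ltrDl divr_gt0.
move=> cp; apply/nbhs_ballP; exists ((r - euclid_dist c p) / 2) => /=.
  by rewrite divr_gt0// subr_gt0.
move=> q [/= h1 h2]; rewrite /closed_disk/=.
apply: le_trans (euclid_dist_triangle p _ _) _.
have := euclid_dist_le_norm p q.
by move: h1 h2; rewrite /ball/=; lra.
Qed.

(** If the centres are closer than [r1 + r2], the point dividing the segment
    between them in ratio [r1 : r2] lies inside both disks. *)
Lemma disjoint_interior_disks c1 c2 r1 r2 : 0 < r1 -> 0 < r2 ->
  interior (closed_disk c1 r1) `&` interior (closed_disk c2 r2) = set0 <->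
  r1 + r2 <= euclid_dist c1 c2.
Proof.
move=> r1_gt0 r2_gt0; rewrite !interior_closed_disk; split=> [dis|le].
  rewrite leNgt; apply/negP => lt.
  have r_gt0 : 0 < r1 + r2 by rewrite addr_gt0.
  pose v := c2 - c1; pose t := r1 / (r1 + r2).
  have t_r : t * (r1 + r2) = r1 by rewrite divfK// gt_eqF.
  have t_gt0 : 0 < t by rewrite divr_gt0.
  have t_lt1 : t < 1 by rewrite ltr_pdivrMr// mul1r ltrDl.
  have v_d : euclid_dist (0, 0) v = euclid_dist c1 c2.
    by rewrite /euclid_dist; congr Num.sqrt; rewrite /v /=; ring.
  suff : set0 (c1 + (t * v.1, t * v.2)) by [].
  rewrite -dis; split; rewrite [X in X _]/mkset.
    by rewrite euclid_dist_along v_d gtr0_norm// -[ltRHS]t_r ltr_pM2l.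
  have -> : c1 + (t * v.1, t * v.2) = c2 + ((t - 1) * v.1, (t - 1) * v.2).
    by rewrite /v; case: (c1) (c2) => [a1 a2] [b1 b2]; congr pair => /=; ring.
  rewrite euclid_dist_along v_d distrC gtr0_norm ?subr_gt0//.
  have -> : r2 = (1 - t) * (r1 + r2) by rewrite mulrBl t_r mul1r addrAC subrr add0r.
  by rewrite ltr_pM2l// subr_gt0.
apply/seteqP; split=> // p [/= h1 h2].
have := euclid_dist_triangle p c1 c2; rewrite (euclid_distC p c2).
by lra.
Qed.

End EuclideanDisks.

(** * Packing disks in a disk *)

Section PackingDisks.
Set Implicit Arguments.
Unset Strict Implicit.
Variables (R : realType) (I : finType) (r : I -> R).
Hypothesis r_gt0 : forall i, 0 < r i.
Implicit Types (C : {set I}) (P : R) (i j k : I).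

Lemma packable_diskP P C :
  packable (closed_disk (0, 0) P) r C <->
  exists c : I -> R * R,
    (forall i, i \in C -> euclid_dist (0, 0) (c i) + r i <= P) /\
    (forall i j, i \in C -> j \in C -> i != j ->
       r i + r j <= euclid_dist (c i) (c j)).
Proof.
split=> -[c [inP dis]]; exists c; split.
- by move=> i iC; apply/closed_disk_subset; [exact: ltW|exact: inP].
- by move=> i j iC jC ij; apply/disjoint_interior_disks => //; exact: dis.
- by move=> i iC; apply/closed_disk_subset; [exact: ltW|exact: inP].
- by move=> i j iC jC ij; apply/disjoint_interior_disks => //; exact: dis.
Qed.

Lemma packable_subset (A : set (R * R)) C C' :
  C' \subset C -> packable A r C -> packable A r C'.
Proof.
move=> /fintype.subsetP sub [c [inA dis]]; exists c.
by split=> [i /sub/inA//|i j /sub iC /sub jC]; exact: dis.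
Qed.

Lemma packable1 P i : r i <= P ->
  packable (closed_disk (0, 0) P) r [set i].
Proof.
move=> riP; apply/packable_diskP; exists (fun=> (0, 0)); split=> [j|j k].
  rewrite inE => /eqP->; rewrite /euclid_dist /= !subrr expr0n addr0.
  by rewrite sqrtr0 add0r.
by rewrite !inE => /eqP-> /eqP->; rewrite eqxx.
Qed.

(** Two disks are placed on a diameter, each touching the boundary of the
    region. *)
Lemma packable2 P i j : i != j -> r i + r j <= P ->
  packable (closed_disk (0, 0) P) r [set i; j].
Proof.
move=> ij rP; have ri := r_gt0 i; have rj := r_gt0 j.
apply/packable_diskP.
exists (fun k => if k == i then (r i - P, 0) else (P - r j, 0)).
split=> [k|k l]; rewrite !inE.
  case/orP => /eqP->; rewrite ?eqxx ?(negPf ij) ?[j == i]eq_sym ?(negPf ij).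
    rewrite -lerBrDr euclid_dist_le /=; last by lra.
    by rewrite le_eqVlt; apply/orP; left; apply/eqP; ring.
  rewrite -lerBrDr euclid_dist_le /=; last by lra.
  by rewrite le_eqVlt; apply/orP; left; apply/eqP; ring.
case/orP => /eqP-> /orP[] /eqP->; rewrite ?eqxx// => _;
  rewrite ?[j == i]eq_sym ?(negPf ij) le_euclid_dist /= ?subrr ?expr0n ?addr0.
all: by [lra|nra].
Qed.

Lemma packable_le P C i : packable (closed_disk (0, 0) P) r C ->
  i \in C -> r i <= P.
Proof.
move=> /packable_diskP[c [inP _]] iC.
by apply: le_trans (inP _ iC); rewrite lerDr euclid_dist_ge0.
Qed.

Lemma packable_le2 P C i j : packable (closed_disk (0, 0) P) r C ->
  i \in C -> j \in C -> i != j -> r i + r j <= P.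
Proof.
move=> /packable_diskP[c [inP dis]] iC jC ij.
have := inP _ iC; have := inP _ jC; have := dis _ _ iC jC ij.
have := euclid_dist_triangle (0, 0) (c i) (c j).
by rewrite (euclid_distC (c i) (0, 0)); lra.
Qed.

(** Two disks of radii [a] and [b] in a disk of radius [a + b] have centres
    [p] and [q] with [a p + b q = 0], because
    [|a p + b q|^2 = a (a + b) |p|^2 + b (a + b) |q|^2 - a b |p - q|^2]
    and [|p| <= b], [|q| <= a], [a + b <= |p - q|]. For the centre [x] of a
    third disk, of radius [s], Stewart's identity
    [a |x - p|^2 + b |x - q|^2 = (a + b) |x|^2 + a |p|^2 + b |q|^2] then
    bounds [s]: containment bounds the norms on the right from above,
    disjointness bounds the distances on the left from below, and the terms in
    [s ^ 2] cancel. *)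
Lemma packable_le3 P C i j k : packable (closed_disk (0, 0) P) r C ->
  i \in C -> j \in C -> k \in C -> i != j -> i != k -> j != k ->
  r i + r j = P ->
  r k * (r i ^+ 2 + r i * r j + r j ^+ 2) <= r i * r j * (r i + r j).
Proof.
move=> pack iC jC kC ij ik jk sumP.
have rikP := packable_le pack kC.
have [c [inP dis]] := (packable_diskP P C).1 pack.
move: (inP _ iC) (inP _ jC) (inP _ kC).
move: (dis _ _ iC jC ij) (dis _ _ iC kC ik) (dis _ _ jC kC jk).
have a0 := r_gt0 i; have b0 := r_gt0 j; have s0 := r_gt0 k.
move: (r i) (r j) (r k) a0 b0 s0 sumP rikP => a b s a0 b0 s0 <- sab.
rewrite !le_euclid_dist; [|lra..].
rewrite -!lerBrDr !euclid_dist_le; [|lra..].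
case: (c i) (c j) (c k) => [p1 p2] [q1 q2] [x1 x2] /=.
rewrite !sub0r !sqrrN => pq xp xq p0 q0 x0.
have p0' : p1 ^+ 2 + p2 ^+ 2 <= b ^+ 2 by apply: le_trans p0 _; lra.
have q0' : q1 ^+ 2 + q2 ^+ 2 <= a ^+ 2 by apply: le_trans q0 _; lra.
have lin0 : (a * p1 + b * q1) ^+ 2 + (a * p2 + b * q2) ^+ 2 <= 0.
  have -> : (a * p1 + b * q1) ^+ 2 + (a * p2 + b * q2) ^+ 2 =
      a * (a + b) * (p1 ^+ 2 + p2 ^+ 2) + b * (a + b) * (q1 ^+ 2 + q2 ^+ 2) -
      a * b * ((p1 - q1) ^+ 2 + (p2 - q2) ^+ 2) by ring.
  have h1 := ler_wpM2l (ltW (mulr_gt0 a0 (addr_gt0 a0 b0))) p0'.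
  have h2 := ler_wpM2l (ltW (mulr_gt0 b0 (addr_gt0 a0 b0))) q0'.
  have h3 := ler_wpM2l (ltW (mulr_gt0 a0 b0)) pq.
  apply: le_trans (lerB (lerD h1 h2) h3) _.
  by rewrite le_eqVlt; apply/orP; left; apply/eqP; ring.
have /andP[/eqP e1 /eqP e2] : (a * p1 + b * q1 == 0) && (a * p2 + b * q2 == 0).
  by rewrite -!(sqrf_eq0 (_ + _)) -paddr_eq0 ?sqr_ge0// eq_le lin0 addr_ge0 ?sqr_ge0.
have stewart : a * ((p1 - x1) ^+ 2 + (p2 - x2) ^+ 2) +
      b * ((q1 - x1) ^+ 2 + (q2 - x2) ^+ 2) =
    (a + b) * (x1 ^+ 2 + x2 ^+ 2) + a * (p1 ^+ 2 + p2 ^+ 2) +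
      b * (q1 ^+ 2 + q2 ^+ 2).
  have -> : (a + b) * (x1 ^+ 2 + x2 ^+ 2) + a * (p1 ^+ 2 + p2 ^+ 2) +
      b * (q1 ^+ 2 + q2 ^+ 2) = (a + b) * (x1 ^+ 2 + x2 ^+ 2) +
      a * (p1 ^+ 2 + p2 ^+ 2) + b * (q1 ^+ 2 + q2 ^+ 2) -
      2 * (x1 * (a * p1 + b * q1) + x2 * (a * p2 + b * q2)).
    by rewrite e1 e2; ring.
  by ring.
have := ler_wpM2l (ltW a0) xp; have := ler_wpM2l (ltW b0) xq.
have := ler_wpM2l (ltW a0) p0'; have := ler_wpM2l (ltW b0) q0'.
have := ler_wpM2l (ltW (addr_gt0 a0 b0)) x0.
by nra.
Qed.

End PackingDisks.

(** * Worst fit and the lex-max set *)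

Section GreedyAndLexMax.
Set Implicit Arguments.
Unset Strict Implicit.
Variables (R : realType) (n : nat) (P w : R) (r : n.-tuple R).
Implicit Types (a b : assignment n) (i j : 'I_n) (c : container n).

Lemma worst_fit_step a i c a' : admits P w r a i c ->
  (forall c', admits P w r a i c' -> c' != c ->
     capacity P w r c' < capacity P w r c) ->
  greedy_step P w r (worst_fit P w r) a i a' <-> a' = put a i c.
Proof.
move=> ac best; split=> [[[d [[ad dmax] ->]]|[none _]]|->].
- have [->//|dc] := eqVneq d c.
  by have := lt_le_trans (best _ ad dc) (dmax _ ac); rewrite ltxx.
- by have := none _ ac.
- left; exists c; split=> //; split=> // c' ac'.
  by have [->//|c'c] := eqVneq c' c; rewrite ltW// best.
Qed.

Lemma worst_fit_skip a i a' : (forall c, ~ admits P w r a i c) ->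
  greedy_step P w r (worst_fit P w r) a i a' <-> a' = a.
Proof.
move=> none; split=> [[[c [[ac _] _]]|[]//]|->]; last by right.
by have := none _ ac.
Qed.

Lemma worst_fit_any_fit b :
  greedy_result P w r (worst_fit P w r) b ->
  greedy_result P w r (any_fit P w r) b.
Proof.
rewrite /greedy_result; elim: (enum _) (empty_assignment n) => //= i s IH a.
move=> [a' [step /IH rest]]; exists a'; split=> //.
by case: step => [[c [[ac _] ->]]|]; [left; exists c|right].
Qed.

Hypothesis inst : is_instance P w r.

Lemma tnth_instance_gt0 i : 0 < tnth r i.
Proof. by case: inst => _ _ /allP r_gt0 _; apply/r_gt0/mem_tnth. Qed.

Lemma tnth_instance_lt i j : tnth r i < tnth r j -> (j < i)%N.
Proof.
case: inst => _ _ _ r_dec; rewrite ltnNge; apply: contraTN => ij.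
rewrite -leNgt; move: ij; rewrite leq_eqVlt => /orP[/eqP/val_inj->//|ij].
rewrite ltW// !(tnth_nth 0); apply: (sorted_ltn_nth _ 0 r_dec) => //.
- by move=> x y z xy zx; exact: lt_trans xy.
- by rewrite inE size_tuple.
- by rewrite inE size_tuple.
Qed.

(** A parent is strictly larger than its child, hence scanned earlier, so that
    truncating a placement of all rings leaves no ring without its parent. *)
Lemma feasible_prefix k : feasible P w r [set: 'I_n]%SET ->
  feasible P w r [set i : 'I_n | (i < k)%N]%SET.
Proof.
move=> [a [aT [par pack]]].
have a_placed i : a i != None 
    by have : i \in placed a; [rewrite aT inE|rewrite inE].
exists [ffun i : 'I_n => if (i < k)%N then a i else None]; split.
  by apply/setP => i; rewrite !inE ffunE; case: ifP; rewrite ?a_placed.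
split=> [i j|c]; last first.
  apply: packable_subset (pack c); apply/fintype.subsetP => i.
  by rewrite !inE ffunE; case: ifP.
rewrite ffunE; case: ifP => // ik /par[_ rij]; split=> //.
rewrite inE ffunE (ltn_trans _ ik) ?a_placed//.
apply: tnth_instance_lt; apply: le_lt_trans rij _.
by case: inst => _ w_gt0 _ _; rewrite ltrBlDr ltrDl.
Qed.

(** As long as every ring has been included, the next set to be tested is a
    prefix of the list of rings, and prefixes are feasible. *)
Lemma lex_max_full : feasible P w r [set: 'I_n]%SET ->
  lex_max P w r = [set: 'I_n]%SET.
Proof.
move=> feas; rewrite /lex_max -[X in foldl _ _ X]take_size size_enum_ord.
set f := (X in foldl X).
have prefix k : (k <= n)%N ->
    foldl f finset.set0 (take k (enum 'I_n)) = [set i : 'I_n | (i < k)%N]%SET.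
  elim: k => [_|k IH kn]; first by rewrite take0; apply/setP => i; rewrite !inE.
  have -> : take k.+1 (enum 'I_n) = rcons (take k (enum 'I_n)) (Ordinal kn).
    by rewrite (take_nth (Ordinal kn)) ?size_enum_ord// (nth_ord_enum _ (Ordinal kn)).
  rewrite foldl_rcons IH ?(ltnW kn)// /f.
  have -> : (Ordinal kn |: [set i : 'I_n | (i < k)%N])%SET =
      [set i : 'I_n | (i < k.+1)%N]%SET.
    by apply/setP => i; rewrite !inE [RHS]ltnS [RHS]leq_eqVlt.
  by rewrite asboolT//; exact: feasible_prefix.
by rewrite prefix//; apply/setP => i; rewrite !inE ltn_ord.
Qed.

End GreedyAndLexMax.

(** * The golden ratio and the tribonacci constant *)

Section Numbers.
Variable R : realType.
Notation phi := (golden R).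

Lemma sqrt5_golden : Num.sqrt 5 = 2 * phi - 1 :> R.
Proof. by rewrite /golden; field. Qed.

Lemma golden_sqr : phi ^+ 2 = phi + 1.
Proof.
have : Num.sqrt 5 ^+ 2 = 5 :> R by rewrite sqr_sqrtr// ler0n.
by rewrite /golden; move: (Num.sqrt 5) => s; nra.
Qed.

Lemma golden_bounds : 8 / 5 < phi < 13 / 8.
Proof.
have p2 := golden_sqr; have p0 : 0 < phi.
  by rewrite /golden; have := sqrtr_ge0 (5 : R); lra.
by apply/andP; split; nra.
Qed.

(** Dividing [x ^ 3 - x ^ 2 - x - 1] by [x - T] leaves a quadratic of negative
    discriminant, so that the root found by the intermediate value theorem is
    the only one. *)
Lemma tribonacci_constant : exists T : R,
  [/\ forall x : R, x ^+ 3 = x ^+ 2 + x + 1 <-> x = T,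
      (1839 + 286 / 1000) / 1000 <= T & T <= (1839 + 29 / 100) / 1000].
Proof.
pose p : {poly R} := 'X^3 - 'X^2 - 'X - 1.
have pE x : p.[x] = x ^+ 3 - x ^+ 2 - x - 1 by rewrite /p !hornerE.
have [||T /andP[T1 T2] /rootP] :=
  @poly_ivt R p ((1839 + 286 / 1000) / 1000) ((1839 + 29 / 100) / 1000).
- by lra.
- by rewrite !pE; lra.
rewrite pE => pT; exists T; split=> // x; split=> [xE|->]; last by lra.
have fac : (x - T) * (x ^+ 2 + (T - 1) * x + (T ^+ 2 - T - 1)) = 0.
  by transitivity ((x ^+ 3 - x ^+ 2 - x - 1) - (T ^+ 3 - T ^+ 2 - T - 1));
     [ring|rewrite pT; lra].
have q_gt0 : 0 < x ^+ 2 + (T - 1) * x + (T ^+ 2 - T - 1).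
  have := sqr_ge0 (x + (T - 1) / 2).
  have : 1839 / 1000 <= T by lra.
  by nra.
by move/eqP: fac; rewrite mulf_eq0 (gt_eqF q_gt0) orbF subr_eq0 => /eqP.
Qed.

End Numbers.

(** * The instance *)

Section Instance.
Set Implicit Arguments.
Unset Strict Implicit.
Variables (R : realType) (phi w eps : R).
Hypotheses (phi_sqr : phi ^+ 2 = phi + 1) (phi_bounds : 8 / 5 < phi < 13 / 8).
Hypotheses (w_bounds : 1 - phi / 2 < w < phi - 1) (eps_gt0 : 0 < eps).
Hypothesis third_fits_hole : phi / 2 + 2 * eps < phi - w.
Hypothesis third_fits_pan : phi / 2 + 2 * eps < 8 * phi - 12.

Let P : R := phi + 1.
Let r : 4.-tuple R := [tuple phi; 1; phi / 2 + 2 * eps; phi / 2 + eps].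

Let i0 : 'I_4 := @Ordinal 4 0 isT.
Let i1 : 'I_4 := @Ordinal 4 1 isT.
Let i2 : 'I_4 := @Ordinal 4 2 isT.
Let i3 : 'I_4 := @Ordinal 4 3 isT.

Let r0E : tnth r i0 = phi. Proof. by []. Qed.
Let r1E : tnth r i1 = 1. Proof. by []. Qed.
Let r2E : tnth r i2 = phi / 2 + 2 * eps. Proof. by []. Qed.
Let r3E : tnth r i3 = phi / 2 + eps. Proof. by []. Qed.
Let rE := (r0E, r1E, r2E, r3E).

Let bounds : [/\ 8 / 5 < phi < 13 / 8, 1 - phi / 2 < w < phi - 1, 0 < eps,
  phi / 2 + 2 * eps < phi - w & phi / 2 + 2 * eps < 8 * phi - 12].
Proof. by split. Qed.

Lemma ord4_ind (Q : 'I_4 -> Prop) : Q i0 -> Q i1 -> Q i2 -> Q i3 ->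
  forall i, Q i.
Proof.
move=> Q0 Q1 Q2 Q3 [[|[|[|[|//]]]] lt].
- by rewrite (_ : Ordinal lt = i0)//; exact: val_inj.
- by rewrite (_ : Ordinal lt = i1)//; exact: val_inj.
- by rewrite (_ : Ordinal lt = i2)//; exact: val_inj.
- by rewrite (_ : Ordinal lt = i3)//; exact: val_inj.
Qed.

Lemma enum_ord4 : enum 'I_4 = [:: i0; i1; i2; i3].
Proof. by apply: (inj_map val_inj); rewrite val_enum_ord. Qed.

Lemma golden_instance : is_instance P w r.
Proof.
have [/andP[pl pu] /andP[wl wu] e0 e2 e3] := bounds.
split; rewrite /P/=; [lra|lra|by rewrite !andbT; apply/and4P; split; lra|].
by rewrite andbT; apply/and3P; split; lra.
Qed.

Let r_gt0 := tnth_instance_gt0 golden_instance.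

(** The disk of radius [phi] touches the pan on the left; the other two are
    mirror images in the diameter through its centre. The bound
    [8 phi - 12 = 4 sqrt 5 - 8] is the radius at which two such disks touch
    each other, the large disk and the pan simultaneously; their centres are
    then [(3 - phi, +- (8 phi - 12))]. Smaller disks fit with the same
    centres. *)
Lemma packable_triple :
  packable (closed_disk (0, 0) P) (tnth r) [set i0; i2; i3]%SET.
Proof.
have p2 := phi_sqr; have [/andP[pl pu] /andP[wl wu] e0 e2 e3] := bounds.
apply/packable_diskP => //.
exists (fun i => if i == i0 then (-1, 0) else
  if i == i2 then (3 - phi, 8 * phi - 12) else (3 - phi, 12 - 8 * phi)).
split.
  apply: ord4_ind; rewrite !inE//= => _; rewrite rE /P -lerBrDr.
  - by rewrite euclid_dist_le /=; lra.
  - apply: (@le_trans _ _ (phi + 1 - (8 * phi - 12))); last by lra.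
    by rewrite euclid_dist_le /=; lra.
  - apply: (@le_trans _ _ (phi + 1 - (8 * phi - 12))); last by lra.
    by rewrite euclid_dist_le /=; lra.
have d02 : phi + (8 * phi - 12) <= euclid_dist (-1, 0) (3 - phi, 8 * phi - 12).
  by rewrite le_euclid_dist /=; lra.
have d03 : phi + (8 * phi - 12) <= euclid_dist (-1, 0) (3 - phi, 12 - 8 * phi).
  by rewrite le_euclid_dist /=; lra.
have d23 : (8 * phi - 12) + (8 * phi - 12) <=
    euclid_dist (3 - phi, 8 * phi - 12) (3 - phi, 12 - 8 * phi).
  by rewrite le_euclid_dist /=; lra.
apply: ord4_ind => //=; apply: ord4_ind; rewrite !inE//= => _ _ _; rewrite !rE.
- by lra.
- by lra.
- by rewrite euclid_distC; lra.
- by lra.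
- by rewrite euclid_distC; lra.
- by rewrite euclid_distC; lra.
Qed.

(** Moving the unit ring into the hole of the large ring frees the pan. *)
Lemma golden_feasible : feasible P w r [set: 'I_4]%SET.
Proof.
have [/andP[pl pu] /andP[wl wu] e0 e2 e3] := bounds.
exists [ffun i => if i == i1 then Some (Some i0) else Some None]; split.
  by apply/setP => i; rewrite !inE ffunE; case: ifP.
split=> [i j|[j|]].
- rewrite ffunE; case: eqP => // -> [<-]; split; first by rewrite inE ffunE.
  by rewrite !rE; lra.
- have [->|j0] := eqVneq j i0.
    apply: (@packable_subset _ _ _ _ [set i1]%SET).
      by apply/fintype.subsetP; apply: ord4_ind; rewrite !inE !ffunE.
    apply: packable1 => //.
    by rewrite /capacity !rE le_max; apply/orP; right; lra.
  apply: (@packable_subset _ _ _ _ finset.set0).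
    apply/fintype.subsetP; apply: ord4_ind; rewrite !inE !ffunE//=.
    by move=> /eqP[] /esym/eqP; rewrite (negPf j0).
  by exists (fun=> (0, 0)); split=> [i|i k]; rewrite inE.
- apply: packable_subset packable_triple.
  by apply/fintype.subsetP; apply: ord4_ind; rewrite !inE !ffunE.
Qed.

Let state1 := put (empty_assignment 4) i0 None.
Let state2 := put state1 i1 None.
Let state3 := put state2 i2 (Some i0).

(** The pan is filled by the rings of radii [phi] and [1], and
    [phi * 1 * (phi + 1) / (phi ^ 2 + phi + 1) = phi / 2] is the radius of the
    largest disk that fits next to them. *)
Lemma pan_blocked (C : {set 'I_4}) k : i0 \in C -> i1 \in C -> k \in C ->
  k != i0 -> k != i1 -> ~ packable (closed_disk (0, 0) P) (tnth r) C.
Proof.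
move=> C0 C1 Ck k0 k1 pack.
have := packable_le3 r_gt0 pack C0 C1 Ck isT.
rewrite ![_ == k]eq_sym k0 k1 => /(_ isT isT erefl).
have p2 := phi_sqr; have [/andP[pl pu] /andP[wl wu] e0 e2 e3] := bounds.
have : phi / 2 < tnth r k.
  by move: k k0 k1 {Ck}; apply: ord4_ind => // _ _; rewrite rE; lra.
rewrite r0E r1E mulr1 expr1n phi_sqr; nra.
Qed.

(** The holes of all rings but the first have radius at most
    [1 - w < phi / 2]. *)
Lemma small_hole_blocked (C : {set 'I_4}) j k : j != i0 -> k != i0 -> k \in C ->
  k != i1 -> ~ packable (region P w r (Some j)) (tnth r) C.
Proof.
have [/andP[pl pu] /andP[wl wu] e0 e2 e3] := bounds.
move=> j0 k0 kC k1 /(packable_le r_gt0) /(_ kC) /=.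
have : phi / 2 < tnth r k.
  by move: k k0 k1 {kC}; apply: ord4_ind => // _ _; rewrite rE; lra.
have : tnth r j <= 1.
  by move: j j0; apply: ord4_ind => // _; rewrite rE; lra.
by move=> rj rk; rewrite le_max => /orP[]; lra.
Qed.

(** Every step is forced: the pan is strictly larger than every hole, and once
    it is blocked only the hole of the first ring can admit anything. *)
Lemma worst_fit_run b :
  greedy_result P w r (worst_fit P w r) b <-> b = state3.
Proof.
have [/andP[pl pu] /andP[wl wu] e0 e2 e3] := bounds.
have pan_largest j : capacity P w r (Some j) < P.
  rewrite /capacity gt_max /P; apply/andP; split; first by lra.
  by move: j; apply: ord4_ind; rewrite rE; lra.
have step1 a : greedy_step P w r (worst_fit P w r) (empty_assignment 4) i0 a <->
    a = state1.
  apply: worst_fit_step => [|[j|//] _ _]; last exact: pan_largest.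
  split=> //; apply: (@packable_subset _ _ _ _ [set i0]%SET).
    by apply/fintype.subsetP; apply: ord4_ind; rewrite !inE !ffunE.
  by apply: packable1 => //; rewrite rE /P /=; lra.
have step2 a : greedy_step P w r (worst_fit P w r) state1 i1 a <-> a = state2.
  apply: worst_fit_step => [|[j|//] _ _]; last exact: pan_largest.
  split=> //; apply: (@packable_subset _ _ _ _ [set i0; i1]%SET).
    by apply/fintype.subsetP; apply: ord4_ind; rewrite !inE !ffunE.
  by apply: packable2 => //; rewrite !rE.
have step3 a : greedy_step P w r (worst_fit P w r) state2 i2 a <-> a = state3.
  apply: worst_fit_step => [|[j|] [_ pack] jc].
  - split; first by rewrite !inE !ffunE.
    apply: (@packable_subset _ _ _ _ [set i2]%SET).
      by apply/fintype.subsetP; apply: ord4_ind; rewrite !inE !ffunE.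
    by apply: packable1 => //; rewrite /= !rE le_max; apply/orP; right; lra.
  - by case: (@small_hole_blocked _ j i2 _ _ _ _ pack) => //; rewrite !inE.
  - by case: (@pan_blocked _ i2 _ _ _ _ _ pack) => //; rewrite !inE !ffunE.
have step4 a : greedy_step P w r (worst_fit P w r) state3 i3 a <-> a = state3.
  apply: worst_fit_skip => -[j|] [_ pack].
    have [j0|j0] := eqVneq j i0; last first.
      by case: (@small_hole_blocked _ j i3 _ _ _ _ pack) => //; rewrite !inE.
    rewrite j0 in pack; have := @packable_le2 _ _ _ r_gt0 _ _ i2 i3 pack.
    rewrite !inE !ffunE /= => /(_ isT isT isT).
    by rewrite !rE le_max => /orP[]; lra.
  by case: (@pan_blocked _ i3 _ _ _ _ _ pack) => //; rewrite !inE !ffunE.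
rewrite /greedy_result enum_ord4 /=; split.
  by move=> [? [/step1-> [? [/step2-> [? [/step3-> [? [/step4-> ->]]]]]]]].
move=> ->; exists state1; split; first exact/step1.
exists state2; split; first exact/step2.
exists state3; split; first exact/step3.
by exists state3; split; first exact/step4.
Qed.

Lemma card_placed_worst_fit : #|placed state3| = 3%N.
Proof.
have -> : placed state3 = (~: [set i3])%SET.
  by apply/setP; apply: ord4_ind; rewrite !inE !ffunE.
by rewrite cardsC1 card_ord.
Qed.

Lemma not_placement_oblivious : ~ placement_oblivious P w r.
Proof.
move=> /(_ state3) obl.
have : placed state3 = [set: 'I_4]%SET.
  rewrite obl; first exact: lex_max_full golden_instance golden_feasible.
  by apply: worst_fit_any_fit; apply/worst_fit_run.
move/(congr1 (fun A : {set 'I_4} => #|A|)).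
by rewrite card_placed_worst_fit cardsT card_ord.
Qed.

(** Since [phi ^ 2 = phi + 1], the ratio of the largest ring is
    [(1 + phi + 3 eps) / phi = phi + 3 eps / phi], less than the ratio [phi + 3 eps] of the unit ring;
    the remaining two ratios are below [1]. *)
Lemma tail_ratio_instance : tail_ratio r = phi + 3 * eps.
Proof.
have p2 := phi_sqr; have [/andP[pl pu] /andP[wl wu] e0 e2 e3] := bounds.
have tailE (i : 'I_4) : \sum_(j < 4 | (i < j)%N) tnth r j =
    [:: 1 + (phi + 3 * eps); phi + 3 * eps; phi / 2 + eps; 0]`_i.
  rewrite big_mkcond /= !big_ord_recl big_ord0.
  by move: i; apply: ord4_ind => /=; rewrite ?(tnth_nth 0) /=; lra.
rewrite /tail_ratio !big_ord_recl big_ord0 !tailE !(tnth_nth 0) /= divr1.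
rewrite [X in Num.max _ X]max_l; last first.
  rewrite !ge_max mul0r; apply/and3P; split; try lra.
  by rewrite ler_pdivrMr; [nra|lra].
by rewrite max_r// ler_pdivrMr; [nra|lra].
Qed.

End Instance.

Theorem theorem19 (R : realType) :
  let phi : R := golden R in
  exists T : R,
    (forall x : R, x ^+ 3 = x ^+ 2 + x + 1 <-> x = T) /\
    `|T - (1839 + 29 / 100) / 1000| < 5 / 10 ^+ 6 /\
    forall omega : R, 1 - phi / 2 < omega -> omega < phi - 1 ->
      let e1 : R := (T - phi) / 3 in
      let e2 : R := (phi / 2 - omega) / 2 in
      let e3 : R := (4 * Num.sqrt 5 - 8 - phi / 2) / 2 in
      (0 < e1 /\ 0 < e2 /\ 0 < e3) /\
      forall eps : R, 0 < eps -> eps < Num.min e1 (Num.min e2 e3) ->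
        let P : R := phi + 1 in
        let r : 4.-tuple R :=
          [tuple phi; 1; phi / 2 + 2 * eps; phi / 2 + eps] in
        is_instance P omega r /\
        tail_ratio r = phi + 3 * eps /\
        phi + 3 * eps < T /\
        lex_max P omega r = [set: 'I_4]%SET /\
        (exists b, greedy_result P omega r (worst_fit P omega r) b) /\
        (forall b, greedy_result P omega r (worst_fit P omega r) b ->
           #|placed b| = 3%N) /\
        ~ placement_oblivious P omega r.
Proof.
have [T [T_root T_gt T_lt]] := tribonacci_constant R.
have := golden_sqr R; have := golden_bounds R; rewrite sqrt5_golden.
move: (golden R) => phi phi_bounds phi_sqr; move: (phi_bounds) => /andP[pl pu] /=.
exists T; split=> //; split.
  by rewrite ltr_norml; apply/andP; split; lra.
move=> w wl wu; split; first by split; [|split]; lra.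
move=> eps e0; rewrite !lt_min => /and3P[e1 e2 e3].
have w_bounds : 1 - phi / 2 < w < phi - 1 by rewrite wl.
have hole : phi / 2 + 2 * eps < phi - w by lra.
have pan : phi / 2 + 2 * eps < 8 * phi - 12 by lra.
have inst := golden_instance phi_bounds w_bounds e0 hole pan.
have run := worst_fit_run phi_sqr phi_bounds w_bounds e0 hole pan.
split=> //; split.
  exact: tail_ratio_instance phi_sqr phi_bounds w_bounds e0 hole pan.
split; first by lra.
split.
  apply: lex_max_full => //.
  exact: golden_feasible phi_sqr phi_bounds w_bounds e0 hole pan.
split; first by eexists; apply/run.
split; first by move=> b /run->; exact: card_placed_worst_fit.
exact: not_placement_oblivious phi_sqr phi_bounds w_bounds e0 hole pan.
Qed.
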